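(* Let $\mathbb{K}$ be a commutative ring. Any two homotopic morphisms of marked categories $f\sim g:\mathcal{M}\to\mathcal{M}'$ induce chain homotopic morphisms of chain complexes $$\Omega f\sim\Omega g:\Omega\mathcal{M}\to\Omega\mathcal{M}',\qquad\Psi f\sim\Psi g:\Psi\mathcal{M}\to\Psi\mathcal{M}'.$$
   Context: A marked category is a pair $\mathcal{M}=(\mathcal{C},M)$ where $\mathcal{C}$ is a small category and $M$ is a set of morphisms of $\mathcal{C}$ containing all identity morphisms. A morphism $(\mathcal{C},M)\to(\mathcal{C}',M')$ is a functor $\mathcal{C}\to\mathcal{C}'$ taking $M$ into $M'$. The complex $\mathsf{N}\mathcal{C}$ is the normalized chain complex over $\mathbb{K}$ of the nerve of $\mathcal{C}$: $(\mathsf{N}\mathcal{C})_0$ is free on the objects of $\mathcal{C}$; for $n\ge1$, $(\mathsf{N}\mathcal{C})_n$ is free on the symbols $\langle\gamma_1,\dots,\gamma_n\rangle$, where $\gamma_1,\dots,\gamma_n$ are composable non-identity morphisms ($\mathrm{codom}(\gamma_i)=\mathrm{dom}(\gamma_{i+1})$); a symbol with some $\gamma_i$ an identity is $0$. The differential is $\partial=\sum_{i=0}^n(-1)^i\tilde d_i$ with $\tilde d_0$ deleting $\gamma_1$, $\tilde d_n$ deleting $\gamma_n$, and $\tilde d_i$ ($1\le i\le n-1$) replacing $\gamma_i,\gamma_{i+1}$ by the composite $\gamma_{i+1}\gamma_i$; for $n=1$, $\tilde d_0\langle\gamma\rangle=\mathrm{codom}(\gamma)$ and $\tilde d_1\langle\gamma\rangle=\mathrm{dom}(\gamma)$.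 $\mathsf{N}M\subseteq\mathsf{N}\mathcal{C}$ is the graded submodule with $(\mathsf{N}M)_0=(\mathsf{N}\mathcal{C})_0$ and $(\mathsf{N}M)_n$ spanned by the $\langle\gamma_1,\dots,\gamma_n\rangle$ with all $\gamma_i\in M$. $\Omega\mathcal{M}$ is the subcomplex of $\mathsf{N}\mathcal{C}$ with $\Omega_n\mathcal{M}=(\mathsf{N}M)_n\cap\partial^{-1}((\mathsf{N}M)_{n-1})$, and $\Psi\mathcal{M}$ is the quotient complex of $\mathsf{N}\mathcal{C}$ with $\Psi_n\mathcal{M}=(\mathsf{N}\mathcal{C})_n/((\mathsf{N}M)_n+\partial((\mathsf{N}M)_{n+1}))$. Both are functorial in $\mathcal{M}$. The box product is $\mathcal{M}\square\mathcal{M}'=(\mathcal{C}\times\mathcal{C}',\{(\mu,1_{c'})\mid\mu\in M,c'\in\mathrm{ob}(\mathcal{C}')\}\cup\{(1_c,\mu')\mid c\in\mathrm{ob}(\mathcal{C}),\mu'\in M'\})$. $I^{\mathsf m}$ is the category with two objects $0,1$ and a single non-identity morphism $0\to1$, with all morphisms marked; $\mathsf{pt}^{\mathsf m}$ is the one-object category with only the identity morphism, marked. The two inclusions $\mathsf{pt}^{\mathsf m}\rightrightarrows I^{\mathsf m}$ (onto the objects $0$ and $1$) induce, via $\mathcal{M}\cong\mathcal{M}\square\mathsf{pt}^{\mathsf m}$, morphisms $i^0,i^1:\mathcal{M}\to\mathcal{M}\square I^{\mathsf m}$. Morphisms $f,g:\mathcal{M}\to\mathcal{M}'$ are one-step homotopic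 if there is a morphism $H:\mathcal{M}\square I^{\mathsf m}\to\mathcal{M}'$ with $Hi^0=f$ and $Hi^1=g$; they are homotopic if they are equivalent under the smallest equivalence relation on morphisms $\mathcal{M}\to\mathcal{M}'$ containing one-step homotopy. *)

(* Defs.v *)
From HB Require Import structures.
From Stdlib Require Import Relation_Operators.
From mathcomp Require Import all_boot all_algebra finmap.
From mathcomp Require Import generic_quotient ring_quotient.
From mathcomp Require Import boolp.
From mathcomp Require Import monalg.

Set Implicit Arguments.
Unset Strict Implicit.
Unset Printing Implicit Defensive.

Import GRing.Theory.
Local Open Scope ring_scope.
Local Open Scope quotient_scope.

#[local] Obligation Tactic := idtac.

Section Submodules.
Variables (K : pzRingType) (V : lmodType K) (S : submodClosed V).

Record submod : predArgType := Submod { submod_val : V; _ : submod_val \in S }.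

HB.instance Definition _ := [isSub for submod_val].
HB.instance Definition _ := [Choice of submod by <:].

Fact submod_closed_subproof : submod_closed (fun x : V => x \in S).
Proof.
by split=> [|a x y xS yS]; rewrite -?topredE /= ?rpred0 ?rpredD ?rpredZ.
Qed.

HB.instance Definition _ :=
  GRing.SubChoice_isSubLmodule.Build K V _ submod
    (GRing.submod_closed_semi submod_closed_subproof).

End Submodules.

Section QuotientModule.
Variables (K : pzRingType) (V : lmodType K) (S : submodClosed V).

Definition submod_mem : {pred V} := fun x => x \in S.

HB.instance Definition _ :=
  GRing.isSubmodClosed.Build K V submod_mem
    (GRing.submod_closed_semi (submod_closed_subproof S)).

Definition quotmod : Type := Quotient.quot submod_mem.
HB.instance Definition _ := GRing.Zmodule.on quotmod.
HB.instance Definition _ := EqQuotient.on quotmod.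

Definition quotmod_pi (x : V) : quotmod := \pi_quotmod x.

Lemma quotmod_piE (x y : V) : (quotmod_pi x == quotmod_pi y) = (x - y \in S).
Proof. exact/esym/(@Quotient.idealrBE V submod_mem). Qed.

Lemma quotmod_ind (P : quotmod -> Prop) :
  (forall x, P (quotmod_pi x)) -> forall u, P u.
Proof. by move=> PV u; rewrite -[u]reprK; apply: PV. Qed.

Fact quotmod_pi_is_zmod_morphism : zmod_morphism quotmod_pi.
Proof. exact: (raddfB (\pi_quotmod : V -> quotmod)). Qed.

Definition quotmod_scale (a : K) (u : quotmod) : quotmod :=
  quotmod_pi (a *: repr u).

Fact quotmod_scaleE a x : quotmod_scale a (quotmod_pi x) = quotmod_pi (a *: x).
Proof.
apply/eqP; rewrite quotmod_piE -scalerBr rpredZ // -quotmod_piE.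
by rewrite /quotmod_pi reprK.
Qed.

Fact quotmod_scaleA a b u :
  quotmod_scale a (quotmod_scale b u) = quotmod_scale (a * b) u.
Proof. by elim/quotmod_ind: u => x; rewrite !quotmod_scaleE scalerA. Qed.

Fact quotmod_scale1 : left_id 1 quotmod_scale.
Proof. by elim/quotmod_ind => x; rewrite quotmod_scaleE scale1r. Qed.

Let piD x y : quotmod_pi (x + y) = quotmod_pi x + quotmod_pi y.
Proof. exact: (raddfD (\pi_quotmod : V -> quotmod)). Qed.

Fact quotmod_scaleDr : right_distributive quotmod_scale +%R.
Proof.
move=> a; elim/quotmod_ind => x; elim/quotmod_ind => y.
by rewrite -piD !quotmod_scaleE scalerDr piD.
Qed.

Fact quotmod_scaleDl u : {morph quotmod_scale^~ u : a b / a + b}.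
Proof.
by move=> a b; elim/quotmod_ind: u => x; rewrite !quotmod_scaleE scalerDl piD.
Qed.

HB.instance Definition _ := GRing.Zmodule_isLmodule.Build K quotmod
  quotmod_scaleA quotmod_scale1 quotmod_scaleDr quotmod_scaleDl.

Fact quotmod_pi_is_linear : linear quotmod_pi.
Proof. by move=> a x y; rewrite piD -quotmod_scaleE. Qed.

HB.instance Definition _ :=
  GRing.isLinear.Build K V quotmod _ quotmod_pi quotmod_pi_is_linear.

End QuotientModule.

Section InducedMaps.
Variables (K : pzRingType) (V W : lmodType K) (f : {linear V -> W}).
Variables (S : submodClosed V) (T : submodClosed W).

Definition submod_map (fST : forall x, x \in S -> f x \in T)
  (u : submod S) : submod T := Submod (fST _ (valP u)).

Fact submod_map_is_linear fST : linear (submod_map fST).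
Proof. by move=> a u v; apply: val_inj; rewrite /= linearP. Qed.

HB.instance Definition _ fST :=
  GRing.isLinear.Build K _ _ _ (submod_map fST) (submod_map_is_linear fST).

Definition quotmod_map (fST : forall x, x \in S -> f x \in T)
  (u : quotmod S) : quotmod T := quotmod_pi T (f (repr u)).

Lemma quotmod_mapE fST x :
  quotmod_map fST (quotmod_pi S x) = quotmod_pi T (f x).
Proof.
apply/eqP; rewrite quotmod_piE -linearB fST // -quotmod_piE.
by rewrite /quotmod_pi reprK.
Qed.

Fact quotmod_map_is_linear fST : linear (quotmod_map fST).
Proof.
move=> a; elim/quotmod_ind => x; elim/quotmod_ind => y.
by rewrite -linearP !quotmod_mapE !linearP.
Qed.

HB.instance Definition _ fST :=
  GRing.isLinear.Build K _ _ _ (quotmod_map fST) (quotmod_map_is_linear fST).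

End InducedMaps.

Arguments submod_map {K V W f S T} fST u.
Arguments quotmod_map {K V W f S T} fST u.

Section Span.
Variables (K : pzRingType) (V : lmodType K) (A : V -> Prop).

Definition span : {pred V} := fun x =>
  `[< exists2 s : seq (K * V),
        (forall cv, cv \in s -> A cv.2) & x = \sum_(cv <- s) cv.1 *: cv.2 >].

Fact span_closed : submod_closed span.
Proof.
split=> [|a x y].
  by apply/asboolP; exists [::]; rewrite ?big_nil.
move=> /asboolP[s As ->] /asboolP[t At ->]; apply/asboolP.
exists ([seq (a * cv.1, cv.2) | cv <- s] ++ t) => [cv|].
  by rewrite mem_cat => /orP[/mapP[cv' /As ? ->]|/At].
rewrite big_cat big_map /= scaler_sumr; congr (_ + _).
by apply: eq_bigr => cv _; rewrite scalerA.
Qed.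

HB.instance Definition _ :=
  GRing.isSubmodClosed.Build K V span (GRing.submod_closed_semi span_closed).

Lemma mem_span x : A x -> x \in span.
Proof.
move=> Ax; apply/asboolP; exists [:: (1, x)] => [cv|].
  by rewrite inE => /eqP->.
by rewrite big_seq1 scale1r.
Qed.

End Span.

(* Free modules.  Multinomials equips [{malg K[T]}] with its K-module         *)
(* structure only over non-trivial rings; the alias [free_mod] carries the    *)
(* same structure over an arbitrary commutative ring.                         *)

Definition free_mod (K : comPzRingType) (T : Type) : Type :=
  {malg K[{classic T}]}.

Section FreeModule.
Variables (K : comPzRingType) (T : Type).
Local Notation F := (free_mod K T).

HB.instance Definition _ := GRing.Zmodule.on F.

Definition free_scale (a : K) (x : F) : F :=
  \sum_(t <- msupp x) << a * x@_t *g t >>.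

Fact free_scaleE a x t : (free_scale a x)@_t = a * x@_t.
Proof.
rewrite {2}[x]monalgE /free_scale !raddf_sum mulr_sumr.
by apply/eq_bigr => /= i _; rewrite !mcoeffU mulrnAr.
Qed.

Fact free_scaleA a b x : free_scale a (free_scale b x) = free_scale (a * b) x.
Proof. by apply/malgP => t; rewrite !free_scaleE mulrA. Qed.

Fact free_scale1 : left_id 1 free_scale.
Proof. by move=> x; apply/malgP => t; rewrite free_scaleE mul1r. Qed.

Fact free_scaleDr : right_distributive free_scale +%R.
Proof.
by move=> a x y; apply/malgP => t; rewrite !(mcoeffD, free_scaleE) mulrDr.
Qed.

Fact free_scaleDl x : {morph free_scale^~ x : a b / a + b}.
Proof.
by move=> a b; apply/malgP => t; rewrite !(mcoeffD, free_scaleE) mulrDl.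
Qed.

HB.instance Definition _ := GRing.Zmodule_isLmodule.Build K F
  free_scaleA free_scale1 free_scaleDr free_scaleDl.

Definition free_gen (t : T) : F := << 1 *g (t : {classic T}) >>.

Lemma free_genE (x : F) : x = \sum_(t <- msupp x) x@_t *: free_gen t.
Proof.
rewrite {1}[x]monalgE; apply: eq_bigr => t _; apply/malgP => u.
by rewrite free_scaleE !mcoeffU mulrnAr mulr1.
Qed.

Variables (V : lmodType K) (f : T -> V).

Definition lin_ext (x : F) : V := \sum_(t <- msupp x) x@_t *: f t.

Let lin_extw (x : F) (D : {fset {classic T}}) :
  (msupp x `<=` D)%fset -> lin_ext x = \sum_(t <- D) x@_t *: f t.
Proof.
move=> xD; apply: big_fset_incl => // t _ /mcoeff_outdom ->.
by rewrite scale0r.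
Qed.

Fact lin_ext_is_linear : linear lin_ext.
Proof.
move=> a x y; set D := (msupp x `|` msupp y `|` msupp (a *: x + y))%fset.
rewrite !(@lin_extw _ D) /D;
  try by apply/fsubsetP => t; rewrite !in_fsetU => ->; rewrite ?orbT.
rewrite scaler_sumr -big_split; apply: eq_bigr => t _ /=.
by rewrite mcoeffD free_scaleE scalerDl scalerA.
Qed.

HB.instance Definition _ := GRing.isLinear.Build K F V _ lin_ext lin_ext_is_linear.

Lemma lin_ext_gen t : lin_ext (free_gen t) = f t.
Proof. by rewrite (lin_extw msuppU_le) big_seq_fset1 mcoeffUU scale1r. Qed.

End FreeModule.

Lemma free_mod_ext (K : comPzRingType) (T : Type) (V : lmodType K)
    (f g : {linear free_mod K T -> V}) :
  (forall t, f (free_gen K t) = g (free_gen K t)) -> forall x, f x = g x.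
Proof.
move=> fg x; rewrite [x]free_genE !linear_sum.
by apply: eq_bigr => t _; rewrite !linearZ fg.
Qed.

(* Chain complexes in non-negative degrees; [diff C n] is the differential    *)
(* from degree n+1 to degree n, the one out of degree 0 being zero.           *)

Record chain_complex (K : pzRingType) := ChainComplex {
  chains :> nat -> lmodType K;
  diff : forall n, {linear chains n.+1 -> chains n};
  diffK : forall n x, diff n (diff n.+1 x) = 0
}.

Record chain_map (K : pzRingType) (C D : chain_complex K) := ChainMap {
  cmap :> forall n, {linear C n -> D n};
  cmap_diff : forall n x, cmap n (diff C n x) = diff D n (cmap n.+1 x)
}.

Definition chain_homotopic (K : pzRingType) (C D : chain_complex K)
    (f g : chain_map C D) : Prop :=
  exists h : forall n, {linear C n -> D n.+1},
    (forall x, g 0%N x - f 0%N x = diff D 0 (h 0%N x)) /\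
    (forall n x, g n.+1 x - f n.+1 x
                 = diff D n.+1 (h n.+1 x) + h n (diff C n x)).

(* [inf_mem S] is the largest subcomplex of C contained in the graded         *)
(* submodule S, and [sup_mem S] the smallest one containing S.                *)

Section GradedSubmodule.
Variables (K : pzRingType) (C : chain_complex K).
Variable (S : forall n, submodClosed (C n)).

Definition inf_mem n : {pred C n} :=
  match n return {pred C n} with
  | 0 => fun x => x \in S 0
  | m.+1 => fun x => (x \in S m.+1) && (diff C m x \in S m)
  end.

Fact inf_closed n : submod_closed (@inf_mem n).
Proof.
have [S0 SP] : submod_closed (fun x => x \in S n).
  exact: submod_closed_subproof.
case: n S0 SP => [|n] S0 SP; first by split=> // a x y; apply: SP.
split=> [|a x y /andP[xS dxS] /andP[yS dyS]]; apply/andP.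
  by rewrite linear0 !rpred0.
by split; rewrite ?linearP; [apply: SP | rewrite rpredD ?rpredZ].
Qed.

HB.instance Definition _ n :=
  GRing.isSubmodClosed.Build K (C n) (@inf_mem n)
    (GRing.submod_closed_semi (inf_closed n)).

Definition sup_mem n : {pred C n} := fun x =>
  `[< exists a b, [/\ a \in S n, b \in S n.+1 & x = a + diff C n b] >].

Fact sup_closed n : submod_closed (@sup_mem n).
Proof.
split=> [|c x y].
  by apply/asboolP; exists 0, 0; rewrite !rpred0 linear0 addr0.
move=> /asboolP[a [b [aS bS ->]]] /asboolP[a' [b' [a'S b'S ->]]].
apply/asboolP; exists (c *: a + a'), (c *: b + b').
by rewrite !rpredD ?rpredZ // linearP scalerDr addrACA.
Qed.

HB.instance Definition _ n :=
  GRing.isSubmodClosed.Build K (C n) (@sup_mem n)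
    (GRing.submod_closed_semi (sup_closed n)).

Fact inf_diff n x : x \in @inf_mem n.+1 -> diff C n x \in @inf_mem n.
Proof.
case: n x => [|n] x /andP[xS dxS] //; apply/andP.
by rewrite diffK rpred0.
Qed.

Fact sup_diff n x : x \in @sup_mem n.+1 -> diff C n x \in @sup_mem n.
Proof.
move=> /asboolP[a [b [aS bS ->]]]; apply/asboolP; exists 0, a.
by rewrite rpred0 linearD diffK addr0 add0r.
Qed.

Definition inf_chains n : lmodType K := submod (@inf_mem n).
Definition inf_diff_map n : {linear inf_chains n.+1 -> inf_chains n} :=
  submod_map (@inf_diff n).

Fact inf_diffK n x : inf_diff_map n (inf_diff_map n.+1 x) = 0.
Proof. by apply: val_inj; rewrite /= diffK. Qed.

Definition inf_complex : chain_complex K := ChainComplex inf_diffK.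

Definition sup_quotient_chains n : lmodType K := quotmod (@sup_mem n).
Definition sup_quotient_diff n :
    {linear sup_quotient_chains n.+1 -> sup_quotient_chains n} :=
  quotmod_map (@sup_diff n).

Fact sup_quotient_diffK n x :
  sup_quotient_diff n (sup_quotient_diff n.+1 x) = 0.
Proof.
elim/quotmod_ind: x => x.
by rewrite /sup_quotient_diff /= !quotmod_mapE diffK linear0.
Qed.

Definition sup_quotient_complex : chain_complex K :=
  ChainComplex sup_quotient_diffK.

End GradedSubmodule.

Section GradedSubmoduleMaps.
Variables (K : pzRingType) (C D : chain_complex K) (f : chain_map C D).
Variables (S : forall n, submodClosed (C n)) (T : forall n, submodClosed (D n)).
Hypothesis fST : forall n x, x \in S n -> f n x \in T n.

Fact inf_cmap n x : x \in @inf_mem K C S n -> f n x \in @inf_mem K D T n.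
Proof.
case: n x => [|n] x; first exact: fST.
by move=> /andP[xS dxS]; apply/andP; rewrite -cmap_diff !fST.
Qed.

Fact sup_cmap n x : x \in @sup_mem K C S n -> f n x \in @sup_mem K D T n.
Proof.
move=> /asboolP[a [b [aS bS ->]]]; apply/asboolP; exists (f n a), (f n.+1 b).
by rewrite !fST // linearD cmap_diff.
Qed.

Definition inf_chain_map_fun n : {linear inf_complex S n -> inf_complex T n} :=
  submod_map (@inf_cmap n).

Fact inf_chain_map_diff n x :
  inf_chain_map_fun n (diff _ n x) = diff _ n (inf_chain_map_fun n.+1 x).
Proof. by apply: val_inj; rewrite /= cmap_diff. Qed.

Definition inf_chain_map : chain_map (inf_complex S) (inf_complex T) :=
  ChainMap inf_chain_map_diff.

Definition sup_quotient_map_fun n :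
    {linear sup_quotient_complex S n -> sup_quotient_complex T n} :=
  quotmod_map (@sup_cmap n).

Fact sup_quotient_map_diff n x :
  sup_quotient_map_fun n (diff _ n x) = diff _ n (sup_quotient_map_fun n.+1 x).
Proof.
elim/quotmod_ind: x => x.
by rewrite /sup_quotient_map_fun /= /sup_quotient_diff !quotmod_mapE cmap_diff.
Qed.

Definition sup_quotient_map :
    chain_map (sup_quotient_complex S) (sup_quotient_complex T) :=
  ChainMap sup_quotient_map_diff.

End GradedSubmoduleMaps.

Record category := Category {
  ob :> Type;
  hom : ob -> ob -> Type;
  idm : forall a, hom a a;
  compose : forall a b c, hom b c -> hom a b -> hom a c;
  compA : forall a b c d (h : hom c d) (g : hom b c) (f : hom a b),
    compose h (compose g f) = compose (compose h g) f;
  comp1m : forall a b (f : hom a b), compose (idm b) f = f;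
  compm1 : forall a b (f : hom a b), compose f (idm a) = f
}.
Arguments idm {c} a : rename.
Arguments compose {c x y z} g f : rename.
Arguments hom {c} a b : rename.

Record functor (C D : category) := Functor {
  fob :> C -> D;
  fhom : forall a b : C, hom a b -> hom (fob a) (fob b);
  fhom1 : forall a : C, fhom (idm a) = idm (fob a);
  fhom_comp : forall (a b c : C) (g : hom b c) (f : hom a b),
    fhom (compose g f) = compose (fhom g) (fhom f)
}.
Arguments fhom {C D} F {a b} f : rename.

Record marked_category := MarkedCategory {
  mcat :> category;
  marked : forall a b : mcat, hom a b -> Prop;
  marked1 : forall a : mcat, marked (idm a)
}.
Arguments marked {m a b} f : rename.

Record marked_morphism (M N : marked_category) := MarkedMorphism {
  mfun :> functor M N;
  mfun_marked : forall (a b : M) (f : hom a b), marked f -> marked (fhom mfun f)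
}.

Section MarkedComposition.
Variables (L M N : marked_category).
Variables (G : marked_morphism M N) (F : marked_morphism L M).

Program Definition functor_comp : functor L N :=
  @Functor L N (fun a => G (F a)) (fun a b f => fhom G (fhom F f)) _ _.
Next Obligation. by move=> a; rewrite /= !fhom1. Qed.
Next Obligation. by move=> a b c g f; rewrite /= !fhom_comp. Qed.

Program Definition marked_comp : marked_morphism L N :=
  @MarkedMorphism L N functor_comp _.
Next Obligation. by move=> a b f fM; do 2!apply: mfun_marked. Qed.

End MarkedComposition.

Program Definition marked_id (M : marked_category) : marked_morphism M M :=
  @MarkedMorphism M M (@Functor M M id (fun a b f => f) _ _) _.
Next Obligation. by []. Qed.
Next Obligation. by []. Qed.
Next Obligation. by []. Qed.

Section BoxProduct.
Variables (M N : marked_category).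

Program Definition prod_category : category :=
  @Category (M * N) (fun p q => (hom p.1 q.1 * hom p.2 q.2)%type)
    (fun p => (idm p.1, idm p.2))
    (fun p q r g f => (compose g.1 f.1, compose g.2 f.2)) _ _ _.
Next Obligation. by move=> ? ? ? ? h g f; rewrite /= !compA. Qed.
Next Obligation. by move=> ? ? [f g]; rewrite /= !comp1m. Qed.
Next Obligation. by move=> ? ? [f g]; rewrite /= !compm1. Qed.

Inductive box_marked : forall p q : prod_category, hom p q -> Prop :=
| BoxMarkedL (a b : M) (f : hom a b) (c : N) :
    marked f -> @box_marked (a, c) (b, c) (f, idm c)
| BoxMarkedR (a : M) (c d : N) (f : hom c d) :
    marked f -> @box_marked (a, c) (a, d) (idm a, f).

Program Definition box : marked_category :=
  @MarkedCategory prod_category box_marked _.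
Next Obligation. by case=> a c; apply: BoxMarkedL; apply: marked1. Qed.

End BoxProduct.

Section BoxMap.
Variables (M M' N N' : marked_category).
Variables (F : marked_morphism M M') (G : marked_morphism N N').

Program Definition box_map : marked_morphism (box M N) (box M' N') :=
  @MarkedMorphism (box M N) (box M' N')
    (@Functor (box M N) (box M' N') (fun p => (F p.1, G p.2))
       (fun p q f => (fhom F f.1, fhom G f.2)) _ _) _.
Next Obligation. by move=> p; rewrite /= !fhom1. Qed.
Next Obligation. by move=> p q r g f; rewrite /= !fhom_comp. Qed.
Next Obligation.
by move=> p q f; case=> /= [a b {}f c|a c d {}f] fM; rewrite fhom1;
  [apply: BoxMarkedL | apply: BoxMarkedR]; apply: mfun_marked.
Qed.

End BoxMap.

(* The thin category on [bool] with one morphism a -> b when [a ==> b].       *)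

Fact interval_comp (a b c : bool) : b ==> c -> a ==> b -> a ==> c.
Proof. by case: a b c => [] [] []. Qed.

Program Definition interval_category : category :=
  @Category bool (fun a b => a ==> b : Type) (fun a => implybb a)
    (@interval_comp) _ _ _.
Next Obligation. by move=> *; apply: bool_irrelevance. Qed.
Next Obligation. by move=> *; apply: bool_irrelevance. Qed.
Next Obligation. by move=> *; apply: bool_irrelevance. Qed.

Definition interval : marked_category :=
  @MarkedCategory interval_category (fun _ _ _ => True) (fun _ => I).

Program Definition pt_category : category :=
  @Category unit (fun _ _ => unit) (fun _ => tt) (fun _ _ _ _ _ => tt) _ _ _.
Next Obligation. by []. Qed.
Next Obligation. by move=> ? ? []. Qed.
Next Obligation. by move=> ? ? []. Qed.

Definition pt : marked_category :=
  @MarkedCategory pt_category (fun _ _ _ => True) (fun _ => I).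

Program Definition pt_interval (e : bool) : marked_morphism pt interval :=
  @MarkedMorphism pt interval
    (@Functor pt interval (fun _ => e) (fun _ _ _ => implybb e) _ _) _.
Next Obligation. by move=> *; apply: bool_irrelevance. Qed.
Next Obligation. by move=> *; apply: bool_irrelevance. Qed.
Next Obligation. by []. Qed.

Program Definition box_pt (M : marked_category) : marked_morphism M (box M pt) :=
  @MarkedMorphism M (box M pt)
    (@Functor M (box M pt) (fun a => (a, tt)) (fun a b f => (f, tt)) _ _) _.
Next Obligation. by []. Qed.
Next Obligation. by []. Qed.
Next Obligation. by move=> M a b f; apply: (@BoxMarkedL M pt a b f tt). Qed.

Definition box_end (M : marked_category) (e : bool) :
    marked_morphism M (box M interval) :=
  marked_comp (box_map (marked_id M) (pt_interval e)) (box_pt M).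

Definition one_step_homotopic (M N : marked_category)
    (f g : marked_morphism M N) : Prop :=
  exists H : marked_morphism (box M interval) N,
    marked_comp H (box_end M false) = f /\ marked_comp H (box_end M true) = g.

Definition homotopic (M N : marked_category) :
    marked_morphism M N -> marked_morphism M N -> Prop :=
  clos_refl_sym_trans _ (@one_step_homotopic M N).

Inductive is_id (C : category) : forall a b : C, hom a b -> Prop :=
| IsId a : is_id (idm a).

(* [composable n a] is the type of the composable g_1, ..., g_n with          *)
(* dom g_1 = a; a 0-simplex is thus an object.                                *)
Fixpoint composable (C : category) (n : nat) (a : C) : Type :=
  match n with
  | 0 => unit
  | m.+1 => {b : C & (hom a b * composable m b)%type}
  end.

Definition simplex (C : category) (n : nat) : Type := {a : C & composable n a}.

(* [inner_face i] replaces g_{i+1}, g_{i+2} by their composite, and deletes   *)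
(* g_{i+1} when it is the last morphism.                                      *)
Fixpoint inner_face (C : category) (n i : nat) (a : C) {struct n} :
    composable n.+1 a -> composable n a :=
  match n return composable n.+1 a -> composable n a with
  | 0 => fun=> tt
  | m.+1 =>
    match i with
    | 0 => fun '(existT b (f, existT c (g, s))) => existT _ c (compose g f, s)
    | j.+1 => fun '(existT b (f, s)) => existT _ b (f, inner_face j s)
    end
  end.

(* Deleting g_n leaves the initial object unchanged, so [face 1] of a         *)
(* 1-simplex is its domain and [face 0] its codomain.                         *)
Definition face (C : category) (n i : nat) (s : simplex C n.+1) : simplex C n :=
  match i, s with
  | 0, existT a (existT b (f, t)) => existT _ b t
  | j.+1, existT a t => existT _ a (inner_face j t)
  end.

Fixpoint composable_all (C : category) (P : forall a b : C, hom a b -> Prop)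
    (n : nat) (a : C) : composable n a -> Prop :=
  match n return composable n a -> Prop with
  | 0 => fun=> True
  | m.+1 => fun '(existT b (f, s)) => P a b f /\ composable_all P s
  end.

Definition nondegenerate (C : category) n (s : simplex C n) : Prop :=
  composable_all (fun _ _ f => ~ is_id f) (projT2 s).

Definition all_marked (M : marked_category) n (s : simplex M n) : Prop :=
  composable_all (fun _ _ f => marked f) (projT2 s).

Definition cons_composable (C : category) n (a b : C) (f : hom a b)
  (s : composable n b) : composable n.+1 a := existT _ b (f, s).

Lemma inner_face_inner_face (C : category) n (a : C) i j
    (s : composable n.+2 a) : (i <= j)%N ->
  inner_face i (inner_face j.+1 s) = inner_face j (inner_face i s).
Proof.
elim: n i j a s => [|n IHn] i j a; first by [].
case=> b [f [c [g [d [h s]]]]]; case: i j => [|i] [|j] // ij.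
  by rewrite /= compA.
exact: (congr1 (cons_composable f) (IHn i j b (existT _ c (g, existT _ d (h, s))) ij)).
Qed.

Lemma face_face (C : category) n i j (s : simplex C n.+2) : (i <= j)%N ->
  face i (face j.+1 s) = face j (face i s).
Proof.
case: s => a [b [f [c [g s]]]]; case: i j => [|i] [|j] // ij.
pose t : composable n.+2 a := existT _ b (f, existT _ c (g, s)).
exact: (congr1 (existT (@composable C n) a) (@inner_face_inner_face _ _ _ i j t ij)).
Qed.

Fixpoint id_at (C : category) (k n : nat) (a : C) {struct n} :
    composable n a -> Prop :=
  match n return composable n a -> Prop with
  | 0 => fun=> False
  | m.+1 => fun '(existT b (f, s)) =>
    match k with 0 => is_id f | l.+1 => id_at l s end
  end.

Lemma id_at_lt (C : category) k n (a : C) (s : composable n a) :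
  id_at k s -> (k < n)%N.
Proof.
elim: n k a s => [|n IHn] [|k] a //= [b [f s]] // /IHn.
by rewrite ltnS.
Qed.

Lemma degenerateP (C : category) n (s : simplex C n) :
  ~ nondegenerate s <-> exists k, id_at k (projT2 s).
Proof.
case: s => a /=; rewrite /nondegenerate /=.
elim: n a => [|n IHn] a s; first by split=> [[]|[]].
case: s => b [f s] /=; split=> [|[[|k] Hk] [fN sN] //]; last first.
  by apply/(IHn _ s): sN; exists k.
have [fI _|fN nN] := EM (is_id f); first by exists 0.
have [|k Hk] := (IHn b s).1; last by exists k.+1.
by move=> sN; apply: nN.
Qed.

Lemma inner_face_id (C : category) n k (a : C) (s : composable n.+1 a) :
  id_at k.+1 s -> inner_face k s = inner_face k.+1 s.
Proof.
elim: n k a s => [|n IHn] k a; first by [].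
case=> b [f]; case: k => [|k] [c [g s]] /= H.
  case: b c g / H f s => b f s; rewrite comp1m; apply: (congr1 (cons_composable f)).
  case: n s {IHn} => [|n] /= => [[]//|[c [g s]]].
  by rewrite compm1.
exact: (congr1 (cons_composable f) (IHn k b (existT _ c (g, s)) H)).
Qed.

Lemma face_id (C : category) n k (s : simplex C n.+1) :
  id_at k (projT2 s) -> face k s = face k.+1 s.
Proof.
case: s => a [b [f s]]; case: k => [|k] /= H; last first.
  pose t : composable n.+1 a := existT _ b (f, s).
  exact: (congr1 (existT (@composable C n) a) (@inner_face_id _ _ k _ t H)).
case: a b f / H s => a s; apply: (congr1 (existT (@composable C n) a)).
by case: n s => [[]|n [c [g s]]] //=; rewrite compm1.
Qed.

Lemma inner_face_id_lt (C : category) n i k (a : C) (s : composable n.+1 a) :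
  (i < k)%N -> id_at k.+1 s -> id_at k (inner_face i s).
Proof.
elim: n i k a s => [|n IHn] i k a [b [f]]; first by move=> s _ [].
by case: i k => [|i] [|k] [c [g s]] // ik; apply: (IHn i k b (existT _ c (g, s))).
Qed.

Lemma inner_face_id_gt (C : category) n i k (a : C) (s : composable n.+1 a) :
  (k < i)%N -> (i <= n)%N -> id_at k s -> id_at k (inner_face i s).
Proof.
elim: n i k a s => [|n IHn] [|i] k a //; case: k => [|k] [b [f s]] // ki im.
by apply: (IHn i k b s).
Qed.

Lemma face_id_lt (C : category) n i k (s : simplex C n.+1) :
  (i < k.+1)%N -> id_at k.+1 (projT2 s) -> id_at k (projT2 (face i s)).
Proof.
case: s => a [b [f s]]; case: i => //= i ik H.
exact: inner_face_id_lt.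
Qed.

Lemma face_id_gt (C : category) n i k (s : simplex C n.+1) :
  (k.+1 < i)%N -> (i <= n.+1)%N -> id_at k (projT2 s) ->
  id_at k (projT2 (face i s)).
Proof. by case: s => a s; case: i => //= i ki im; apply: inner_face_id_gt. Qed.

Section Nerve.
Variables (K : comPzRingType) (C : category).

Definition nerve_chains (n : nat) : lmodType K :=
  free_mod K {s : simplex C n | nondegenerate s}.

Definition symbol n (s : simplex C n) : nerve_chains n :=
  if pselect (nondegenerate s) is left ns then free_gen K (exist _ s ns) else 0.

Definition nerve_boundary n (s : simplex C n.+1) : nerve_chains n :=
  \sum_(i < n.+2) (-1) ^+ i *: symbol (face i s).

Definition nerve_diff n : {linear nerve_chains n.+1 -> nerve_chains n} :=
  lin_ext (fun s : {s : simplex C n.+1 | nondegenerate s} =>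
             nerve_boundary (sval s)).

Lemma symbol_degenerate n (s : simplex C n) : ~ nondegenerate s -> symbol s = 0.
Proof. by rewrite /symbol; case: pselect. Qed.

Lemma free_gen_symbol n (s : {s : simplex C n | nondegenerate s}) :
  free_gen K s = symbol (sval s).
Proof.
case: s => s ns; rewrite /symbol /=; case: pselect => // ns'.
by rewrite (Prop_irrelevance ns ns').
Qed.

Lemma nerve_boundary_degenerate n (s : simplex C n.+1) :
  ~ nondegenerate s -> nerve_boundary s = 0.
Proof.
move=> /degenerateP[k kI]; have kn := id_at_lt kI.
pose k0 : 'I_n.+2 := Ordinal (ltnW kn : (k < n.+2)%N).
pose k1 : 'I_n.+2 := Ordinal (kn : (k.+1 < n.+2)%N).
rewrite /nerve_boundary (bigD1 k0) // (bigD1 k1) /=; last first.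
  by rewrite -val_eqE /= gtn_eqF.
rewrite addrA (face_id kI) exprS mulN1r scaleNr subrr add0r.
apply: big1 => i; rewrite -!val_eqE /= => /andP[ik ik1].
rewrite symbol_degenerate ?scaler0 //; apply/degenerateP.
have := ltn_ord i; case: (ltngtP i k) ik => // ik _ iN.
  by case: k kI {kn k0 k1 ik1} ik => // k kI ik; exists k; apply: face_id_lt.
by exists k; apply: face_id_gt => //; rewrite ltn_neqAle eq_sym ik1.
Qed.

Lemma nerve_diff_symbol n (s : simplex C n.+1) :
  nerve_diff n (symbol s) = nerve_boundary s.
Proof.
have [ns|dns] := pselect (nondegenerate s).
  by rewrite -(free_gen_symbol (exist _ s ns)) /= lin_ext_gen.
by rewrite symbol_degenerate // linear0 nerve_boundary_degenerate.
Qed.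

Fact nerve_diffK n (x : nerve_chains n.+2) :
  nerve_diff n (nerve_diff n.+1 x) = 0.
Proof.
pose dd : {linear nerve_chains n.+2 -> nerve_chains n} :=
  nerve_diff n \o nerve_diff n.+1.
pose zz : {linear nerve_chains n.+2 -> nerve_chains n} := \0.
rewrite -[LHS]/(dd x) -[RHS]/(zz x); apply: free_mod_ext => -[s ns].
rewrite free_gen_symbol /dd /zz /= nerve_diff_symbol linear_sum /=.
under eq_bigr do rewrite linearZ /= nerve_diff_symbol scaler_sumr.
under eq_bigr do under eq_bigr do rewrite scalerA -exprD.
under eq_bigr => j _ do rewrite (bigID (fun i : 'I_n.+2 => i < j)%N) /=.
rewrite big_split /= big_ord_recl [X in _ + X]big_ord_recr /=.
rewrite [X in X + _ + _]big_pred0 // add0r.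
rewrite [X in _ + (_ + X)]big_pred0 ?addr0; last by move=> i; rewrite ltn_ord.
apply/eqP; rewrite addr_eq0 -sumrN; apply/eqP.
under eq_bigr do rewrite big_mkcond /=.
under [RHS]eq_bigr do rewrite -sumrN big_mkcond /=.
rewrite exchange_big; apply: eq_bigr => i _; apply: eq_bigr => j _ /=.
rewrite /bump /= add1n ltnS -leqNgt; case: ifP => // ij.
by rewrite face_face // addSn exprS mulN1r scaleNr addnC.
Qed.

Definition nerve_complex : chain_complex K := ChainComplex nerve_diffK.

End Nerve.

Section NerveMap.
Variables (K : comPzRingType) (C D : category) (F : functor C D).

Fixpoint map_composable n (a : C) : composable n a -> composable n (F a) :=
  match n return composable n a -> composable n (F a) with
  | 0 => fun=> tt
  | m.+1 => fun '(existT b (f, s)) =>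
      existT _ (F b) (fhom F f, map_composable s)
  end.

Definition map_simplex n (s : simplex C n) : simplex D n :=
  existT _ (F (projT1 s)) (map_composable (projT2 s)).

Definition nerve_map_fun n :
    {linear nerve_complex K C n -> nerve_complex K D n} :=
  lin_ext (fun s : {s : simplex C n | nondegenerate s} =>
             symbol K (map_simplex (sval s))).

Lemma map_inner_face n i (a : C) (s : composable n.+1 a) :
  map_composable (inner_face i s) = inner_face i (map_composable s).
Proof.
elim: n i a s => [|n IHn] i a //.
case: i => [|i] [b [f [c [g s]]]] /=; first by rewrite fhom_comp.
exact: (congr1 (cons_composable _) (IHn i b (existT _ c (g, s)))).
Qed.

Lemma map_face n i (s : simplex C n.+1) :
  map_simplex (face i s) = face i (map_simplex s).
Proof.
case: s => a [b [f s]]; case: i => [|i] //.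
exact: (congr1 (existT (@composable D n) (F a)) (map_inner_face i _)).
Qed.

Lemma map_id_at k n (a : C) (s : composable n a) :
  id_at k s -> id_at k (map_composable s).
Proof.
elim: n k a s => [|n IHn] [|k] a //= [b [f s]] /=; last exact: IHn.
by move=> H; case: a b f / H s => a s; rewrite fhom1.
Qed.

Lemma nerve_map_symbol n (s : simplex C n) :
  nerve_map_fun n (symbol K s) = symbol K (map_simplex s).
Proof.
have [ns|dns] := pselect (nondegenerate s).
  by rewrite -(free_gen_symbol K (exist _ s ns)) /= lin_ext_gen.
rewrite !symbol_degenerate ?linear0 //.
move: dns => /degenerateP[k kI]; apply/degenerateP; exists k.
exact: map_id_at.
Qed.

Fact nerve_map_diff n x :
  nerve_map_fun n (diff _ n x) = diff _ n (nerve_map_fun n.+1 x).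
Proof.
pose l : {linear nerve_complex K C n.+1 -> nerve_complex K D n} :=
  nerve_map_fun n \o diff _ n.
pose r : {linear nerve_complex K C n.+1 -> nerve_complex K D n} :=
  diff _ n \o nerve_map_fun n.+1.
rewrite -[LHS]/(l x) -[RHS]/(r x); apply: free_mod_ext => -[s ns].
rewrite free_gen_symbol /l /r /=.
rewrite [in RHS]nerve_map_symbol !nerve_diff_symbol linear_sum.
by apply: eq_bigr => i _; rewrite linearZ /= nerve_map_symbol map_face.
Qed.

Definition nerve_map : chain_map (nerve_complex K C) (nerve_complex K D) :=
  ChainMap nerve_map_diff.

End NerveMap.

Definition marked_chains (K : comPzRingType) (M : marked_category) (n : nat) :
    submodClosed (nerve_complex K M n) :=
  span (fun x : nerve_complex K M n =>
          exists2 s : simplex M n, all_marked s & x = symbol K s).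

Lemma marked_chains0 (K : comPzRingType) (M : marked_category) x :
  x \in marked_chains K M 0.
Proof.
rewrite [x]free_genE rpred_sum // => s _; rewrite rpredZ // free_gen_symbol.
by apply: mem_span; exists (sval s); case: s => -[].
Qed.

Fact nerve_map_marked (K : comPzRingType) (M N : marked_category)
    (F : marked_morphism M N) n (x : nerve_complex K M n) :
  x \in marked_chains K M n -> nerve_map K F n x \in marked_chains K N n.
Proof.
move=> /asboolP[s sM ->]; rewrite linear_sum big_seq rpred_sum //.
move=> cv /sM[t tM ->]; rewrite linearZ rpredZ //= nerve_map_symbol.
apply: mem_span; exists (map_simplex F t) => //.
case: t tM => a t; rewrite /all_marked /=.
elim: n a t {x s sM cv} => [|n IHn] a //= [b [f t]] [fM tM] /=.
by split; [apply: mfun_marked | apply: IHn].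
Qed.

Definition Omega (K : comPzRingType) (M : marked_category) : chain_complex K :=
  inf_complex (marked_chains K M).

Definition Psi (K : comPzRingType) (M : marked_category) : chain_complex K :=
  sup_quotient_complex (marked_chains K M).

Definition Omega_map (K : comPzRingType) (M N : marked_category)
    (f : marked_morphism M N) : chain_map (Omega K M) (Omega K N) :=
  inf_chain_map (@nerve_map_marked K M N f).

Definition Psi_map (K : comPzRingType) (M N : marked_category)
    (f : marked_morphism M N) : chain_map (Psi K M) (Psi K N) :=
  sup_quotient_map (@nerve_map_marked K M N f).

(* Main.v *)
From mathcomp Require Import all_boot all_algebra.
From mathcomp Require Import boolp.
Require Import Defs.

(** The cylinder [M [] I] turns a one-step homotopy into a natural
    transformation [tau : F => G] with marked components.  The prism operator
    <g_1, ..., g_n> |-> sum_k (-1)^k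
      <F g_1, ..., F g_k, tau, G g_(k+1), ..., G g_n>
    is a chain homotopy from [F] to [G] on nerves and preserves marked chains.
    A homotopy preserving a graded submodule [S] descends both to the largest
    subcomplex inside [S] and to the quotient by the smallest subcomplex
    containing [S], because [d h = g - f - h d]. *)

Set Implicit Arguments.
Unset Strict Implicit.
Unset Printing Implicit Defensive.

Import GRing.Theory.
Local Open Scope ring_scope.

(* [submodClosed] does not inherit [zmodClosed], so [rpredB] does not apply.  *)
Lemma submod_rpredB (K : pzRingType) (V : lmodType K) (S : submodClosed V) x y :
  x \in S -> y \in S -> x - y \in S.
Proof. by move=> xS yS; rewrite -scaleN1r rpredD ?rpredZ. Qed.

(** * Chain homotopies and their descent to sub- and quotient complexes *)

Section ChainHomotopy.
Variables (K : pzRingType) (C D : chain_complex K).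

Lemma chain_homotopic_refl (f : chain_map C D) : chain_homotopic f f.
Proof.
exists (fun n => \0 : {linear C n -> D n.+1}).
by split=> [x|n x]; rewrite subrr linear0 ?addr0.
Qed.

Lemma chain_homotopic_sym (f g : chain_map C D) :
  chain_homotopic f g -> chain_homotopic g f.
Proof.
case=> h [h0 hS]; exists (fun n => \- (h n) : {linear C n -> D n.+1}).
split=> [x|n x]; rewrite -opprB ?h0 ?hS /= linearN //.
by rewrite opprD.
Qed.

Lemma chain_homotopic_trans (f g k : chain_map C D) :
  chain_homotopic f g -> chain_homotopic g k -> chain_homotopic f k.
Proof.
case=> h [h0 hS] [h' [h'0 h'S]].
exists (fun n => h n \+ h' n : {linear C n -> D n.+1}).
split=> [x|n x] /=; rewrite linearD.
  by rewrite -h0 -h'0 [RHS]addrC addrA subrK.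
by rewrite addrACA -hS -h'S [RHS]addrC addrA subrK.
Qed.

Variables (f g : chain_map C D) (h : forall n, {linear C n -> D n.+1}).
Hypothesis h0 : forall x, g 0%N x - f 0%N x = diff D 0 (h 0%N x).
Hypothesis hS : forall n x,
  g n.+1 x - f n.+1 x = diff D n.+1 (h n.+1 x) + h n (diff C n x).
Variables (S : forall n, submodClosed (C n)) (T : forall n, submodClosed (D n)).
Hypothesis fST : forall n x, x \in S n -> f n x \in T n.
Hypothesis gST : forall n x, x \in S n -> g n x \in T n.
Hypothesis hST : forall n x, x \in S n -> h n x \in T n.+1.

(** In [d (h x) = g x - f x - h (d x)] each term on the right lies in [T], since membership of [x]
    includes that of [d x]. In degree 0 the last term is absent. *)
Lemma inf_homotopy n x :
  x \in @inf_mem K C S n -> h n x \in @inf_mem K D T n.+1.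
Proof.
case: n x => [|n] x.
  move=> xS; apply/andP; split; first exact: hST.
  by rewrite -h0 submod_rpredB ?fST ?gST.
move=> /andP[xS dxS]; apply/andP; split; first exact: hST.
rewrite -[diff D _ _](addrK (h n (diff C n x))) -hS.
by rewrite !submod_rpredB ?hST ?fST ?gST.
Qed.

Lemma sup_homotopy n x :
  x \in @sup_mem K C S n -> h n x \in @sup_mem K D T n.+1.
Proof.
move=> /asboolP[a [b [aS bS ->]]]; apply/asboolP.
(* The homotopy formula turns [h (d b)] into [(g b - f b) - d (h b)]. *)
exists (h n a + (g n.+1 b - f n.+1 b)), (- h n.+1 b).
split; first by rewrite rpredD ?submod_rpredB ?hST ?fST ?gST.
  by rewrite -scaleN1r rpredZ ?hST.
by rewrite hS linearD linearN -addrA; congr (_ + _); rewrite addrAC subrr add0r.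
Qed.

Lemma inf_chain_homotopic :
  chain_homotopic (inf_chain_map fST) (inf_chain_map gST).
Proof.
exists (fun n => submod_map (@inf_homotopy n)).
by split=> [x|n x]; apply: val_inj; rewrite /= ?h0 ?hS.
Qed.

Lemma sup_chain_homotopic :
  chain_homotopic (sup_quotient_map fST) (sup_quotient_map gST).
Proof.
exists (fun n => quotmod_map (@sup_homotopy n)).
split=> [|n]; elim/quotmod_ind => x /=.
  rewrite /sup_quotient_map_fun /sup_quotient_diff /= !quotmod_mapE.
  by rewrite -linearB h0.
rewrite /sup_quotient_map_fun /sup_quotient_diff /= !quotmod_mapE.
by rewrite -linearB -linearD hS.
Qed.

End ChainHomotopy.

(* [x i k] is the [i]-th face of the [k]-th prism and [y j k] the [k]-th      *)
(* prism of the [j]-th face: only the faces [i = k] and [i = k + 1] survive,  *)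
(* and these telescope.                                                       *)
Lemma prism_sum (K : pzRingType) (V : lmodType K) n (x y : nat -> nat -> V) :
  (forall i k, (i <= k <= n)%N -> x i k.+1 = y i k) ->
  (forall i k, (k <= i <= n)%N -> x i.+2 k = y i.+1 k) ->
  (forall k, (k <= n)%N -> x k.+1 k = x k.+1 k.+1) ->
  \sum_(0 <= k < n.+2) \sum_(0 <= i < n.+3) (-1) ^+ (i + k) *: x i k
  + \sum_(0 <= k < n.+1) \sum_(0 <= j < n.+2) (-1) ^+ (j + k) *: y j k
  = x 0 0 - x n.+2 n.+1.
Proof.
move=> xlow xhigh xmid.
(* Splits off the faces [i < k], the faces [i > k + 1] (reindexed by one), and the two middle faces,
   whose signs are opposite. *)
have split_x k : (k < n.+2)%N ->
    \sum_(0 <= i < n.+3) (-1) ^+ (i + k) *: x i k =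
    \sum_(0 <= i < k) (-1) ^+ (i + k) *: x i k
    + \sum_(k.+1 <= i < n.+2) (-1) ^+ (i.+1 + k) *: x i.+1 k
    + (x k k - x k.+1 k).
  move=> kn; have kn1 : (k < n.+3)%N by rewrite ltnS ltnW.
  rewrite (big_cat_nat (n := k)) ?(ltnW kn1) //=.
  rewrite (big_ltn kn1) (big_ltn (kn : (k.+1 < n.+3)%N)).
  rewrite big_add1 /= addSn exprS -[(-1) ^+ (k + k)]signr_odd addnn odd_double.
  rewrite mulr1 scale1r scaleN1r -addrA; congr (_ + _).
  by rewrite addrA addrC.
have split_y k : (k < n.+1)%N ->
    \sum_(0 <= j < n.+2) (-1) ^+ (j + k) *: y j k =
    \sum_(0 <= j < k.+1) (-1) ^+ (j + k) *: y j k
    + \sum_(k.+1 <= j < n.+2) (-1) ^+ (j + k) *: y j k.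
  by move=> kn; rewrite (big_cat_nat (n := k.+1)) // ltnS ltnW.
rewrite (eq_big_nat _ _ (m := 0) (n := n.+2) split_x).
rewrite (eq_big_nat _ _ (m := 0) (n := n.+1) split_y).
rewrite !big_split /=.
(* There are no low faces for [k = 0] and no high ones for [k = n + 1], so both sums now run over
   the same [k] as those of [y]. *)
rewrite [X in X + _ + _ + _]big_nat_recl // big_geq // add0r.
rewrite [X in _ + X + _ + _]big_nat_recr //=.
rewrite [X in _ + (_ + X) + _ + _]big_geq // addr0.
(* Low and high parts cancel against those of [y]: in each, one index is shifted by one, which flips
   the sign. *)
have -> : \sum_(0 <= k < n.+1)
      \sum_(0 <= i < k.+1) (-1) ^+ (i + k.+1) *: x i k.+1
    = - \sum_(0 <= k < n.+1) \sum_(0 <= j < k.+1) (-1) ^+ (j + k) *: y j k.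
  rewrite -sumrN; apply: eq_big_nat => k kn; rewrite -sumrN.
  apply: eq_big_nat => i ik; rewrite xlow; last by apply/andP.
  by rewrite addnS exprS mulN1r scaleNr.
have -> : \sum_(0 <= k < n.+1)
      \sum_(k.+1 <= i < n.+2) (-1) ^+ (i.+1 + k) *: x i.+1 k
    = - \sum_(0 <= k < n.+1) \sum_(k.+1 <= j < n.+2) (-1) ^+ (j + k) *: y j k.
  rewrite -sumrN; apply: eq_big_nat => k kn; rewrite -sumrN.
  apply: eq_big_nat => -[|i] // ik; rewrite xhigh // addSn exprS mulN1r.
  by rewrite scaleNr.
rewrite -opprD addrAC addNr add0r sumrN.
(* Telescoping: [xmid] matches all middle terms except the first and the last. *)
rewrite [X in X - _]big_nat_recl // [X in _ - X]big_nat_recr //=.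
rewrite (eq_big_nat _ _ (m := 0) (n := n.+1) (F1 := fun k => x k.+1 k) xmid).
by rewrite opprD addrACA addrA subrK.
Qed.

(** * The prism operator of a natural transformation *)

Section Prism.
Variables (C D : category) (F G : functor C D).
Variable tau : forall a : C, hom (F a) (G a).
Hypothesis tau_natural : forall (a b : C) (f : hom a b),
  compose (fhom G f) (tau a) = compose (tau b) (fhom F f).

(* Junk value: [prism k] is [prism n] for [n < k] on [composable n].          *)
Fixpoint prism n k (a : C) : composable n a -> composable n.+1 (F a) :=
  match n return composable n a -> composable n.+1 (F a) with
  | 0 => fun s => cons_composable (tau a) (map_composable G s)
  | m.+1 =>
    match k with
    | 0 => fun s => cons_composable (tau a) (map_composable G s)
    | l.+1 => fun '(existT b (f, s)) =>
        cons_composable (fhom F f) (prism l s)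
    end
  end.

Definition prism_simplex n k (s : simplex C n) : simplex D n.+1 :=
  existT _ (F (projT1 s)) (prism k (projT2 s)).

(** The face composes two arrows before [tau], so functoriality of [F] applies. *)
Lemma inner_face_prism_lt n i k (a : C) (s : composable n.+1 a) :
  (i < k <= n)%N -> inner_face i (prism k.+1 s) = prism k (inner_face i s).
Proof.
elim: n i k a s => [|n IHn] i k a s; first by case: k => [|k]; rewrite ?andbF.
case: i k s => [|i] [|k] // [b [f [c [g s]]]] ik.
  by rewrite /= fhom_comp.
exact: (congr1 (cons_composable (fhom F f))
  (IHn i k b (existT _ c (g, s)) ik)).
Qed.

(** The face acts after [tau], within the image of [G]; the shift by one accounts for the inserted
    [tau]. *)
Lemma inner_face_prism_gt n i k (a : C) (s : composable n.+1 a) :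
  (k <= i <= n)%N -> inner_face i.+1 (prism k s) = prism k (inner_face i s).
Proof.
elim: n i k a s => [|n IHn] i [|k] a //.
- by case: i => // i s; rewrite andbF.
- move=> s _.
  transitivity (cons_composable (tau a) (inner_face i (map_composable G s))).
    by case: s => b [f s].
  by rewrite -map_inner_face; case: n s {IHn}.
- case: i => // i [b [f s]] ik.
  exact: (congr1 (cons_composable (fhom F f)) (IHn i k b s ik)).
Qed.

(** Both faces compose [tau] with its neighbour; the composites are the two sides of a naturality
    square. *)
Lemma inner_face_prism_eq n k (a : C) (s : composable n a) :
  (k < n)%N -> inner_face k (prism k s) = inner_face k (prism k.+1 s).
Proof.
elim: n k a s => [|n IHn] [|k] a // [b [f s]] kn.
  (* [prism] recurses on the length first, so even [prism 0] reduces only once the length is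
     exposed. *)
  case: n s {IHn kn} => [|n] s; first by rewrite /= tau_natural.
  by rewrite /= tau_natural.
exact: (congr1 (cons_composable (fhom F f)) (IHn k b s kn)).
Qed.

Lemma inner_face_prism_last n (a : C) (s : composable n a) :
  inner_face n (prism n s) = map_composable F s.
Proof.
elim: n a s => [|n IHn] a; first by case.
case=> b [f s].
exact: (congr1 (cons_composable (fhom F f)) (IHn b s)).
Qed.

Lemma face_prism_lt n i k (s : simplex C n.+1) : (i <= k <= n)%N ->
  face i (prism_simplex k.+1 s) = prism_simplex k (face i s).
Proof.
case: s => a [b [f s]]; case: i => [|i] // ik.
pose t : composable n.+1 a := existT _ b (f, s).
exact: (congr1 (existT (@composable D n.+1) (F a))
  (@inner_face_prism_lt _ _ _ _ t ik)).
Qed.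

Lemma face_prism_gt n i k (s : simplex C n.+1) : (k <= i <= n)%N ->
  face i.+2 (prism_simplex k s) = prism_simplex k (face i.+1 s).
Proof.
case: s => a s ik.
exact: (congr1 (existT (@composable D n.+1) (F a))
  (@inner_face_prism_gt _ _ _ _ s ik)).
Qed.

Lemma face_prism_eq n k (s : simplex C n.+1) : (k <= n)%N ->
  face k.+1 (prism_simplex k s) = face k.+1 (prism_simplex k.+1 s).
Proof.
case: s => a s kn.
exact: (congr1 (existT (@composable D n.+1) (F a))
  (@inner_face_prism_eq _ _ _ s kn)).
Qed.

Lemma face_prism_first n (s : simplex C n) :
  face 0 (prism_simplex 0 s) = map_simplex G s.
Proof. by case: n s => [|n] [a s]. Qed.

Lemma face_prism_last n (s : simplex C n) :
  face n.+1 (prism_simplex n s) = map_simplex F s.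
Proof.
case: s => a s.
exact: (congr1 (existT (@composable D n) (F a)) (inner_face_prism_last s)).
Qed.

(** Functors preserve identities; the position moves by one when the identity comes after [tau],
    hence the existential. *)
Lemma prism_id_at n j k (a : C) (s : composable n a) :
  id_at j s -> exists l, id_at l (prism k s).
Proof.
elim: n j k a s => [|n IHn] j [|k] a // s sj.
  by exists j.+1; exact: (map_id_at G sj).
case: s sj => b [f s]; case: j => [fI|j sj]; last first.
  by have [l sl] := IHn j k b s sj; exists l.+1.
exists 0%N; rewrite /= in fI *.
by case: a b f / fI s => a s; rewrite fhom1.
Qed.

Variable K : comPzRingType.

Definition prism_chain n (s : simplex C n) : nerve_complex K D n.+1 :=
  \sum_(0 <= k < n.+1) (-1) ^+ k *: symbol K (prism_simplex k s).

Definition prism_map n :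
    {linear nerve_complex K C n -> nerve_complex K D n.+1} :=
  lin_ext (fun s : {s : simplex C n | nondegenerate s} => prism_chain (sval s)).

(** On degenerate simplices both sides vanish. This case matters because faces of nondegenerate
    simplices can be degenerate. *)
Lemma prism_map_symbol n (s : simplex C n) :
  prism_map n (symbol K s) = prism_chain s.
Proof.
have [ns|dns] := pselect (nondegenerate s).
  by rewrite -(free_gen_symbol K (exist _ s ns)) /= lin_ext_gen.
rewrite symbol_degenerate // linear0 /prism_chain big1 // => k _.
move: dns => /degenerateP[j sj]; rewrite symbol_degenerate ?scaler0 //.
exact/degenerateP/(prism_id_at k sj).
Qed.

Lemma prism_map_diff0 x :
  nerve_map K G 0 x - nerve_map K F 0 x = diff _ 0 (prism_map 0 x).
Proof.
pose l : {linear nerve_complex K C 0 -> nerve_complex K D 0} :=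
  nerve_map K G 0 \- nerve_map K F 0.
pose r : {linear nerve_complex K C 0 -> nerve_complex K D 0} :=
  diff _ 0 \o prism_map 0.
rewrite -[LHS]/(l x) -[RHS]/(r x); apply: free_mod_ext => s.
rewrite free_gen_symbol /l /r /= [in RHS]prism_map_symbol !nerve_map_symbol.
rewrite /prism_chain big_nat1 scale1r nerve_diff_symbol /nerve_boundary.
rewrite !big_ord_recl big_ord0 addr0 expr0 scale1r expr1 scaleN1r.
by rewrite face_prism_first face_prism_last.
Qed.

Lemma prism_map_diff n x :
  nerve_map K G n.+1 x - nerve_map K F n.+1 x
  = diff _ n.+1 (prism_map n.+1 x) + prism_map n (diff _ n x).
Proof.
pose l : {linear nerve_complex K C n.+1 -> nerve_complex K D n.+1} :=
  nerve_map K G n.+1 \- nerve_map K F n.+1.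
pose r : {linear nerve_complex K C n.+1 -> nerve_complex K D n.+1} :=
  (diff _ n.+1 \o prism_map n.+1) \+ (prism_map n \o diff _ n).
rewrite -[LHS]/(l x) -[RHS]/(r x); apply: free_mod_ext => -[s ns].
rewrite free_gen_symbol /l /r /= [in RHS]prism_map_symbol !nerve_map_symbol.
rewrite nerve_diff_symbol /prism_chain /nerve_boundary !linear_sum /=.
pose dP i k := symbol K (face i (prism_simplex k s)).
pose Pd j k := symbol K (prism_simplex k (face j s)).
(* The images under [G] and [F] are the two outermost faces, the terms surviving in [prism_sum]. *)
rewrite -face_prism_first -face_prism_last -[LHS]/(dP 0 0 - dP n.+2 n.+1).
rewrite -(@prism_sum _ _ n dP Pd); first last.
- by move=> k kn; rewrite /dP face_prism_eq.
- by move=> i k kn; rewrite /dP face_prism_gt.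
- by move=> i k kn; rewrite /dP face_prism_lt.
congr (_ + _).
  apply: eq_bigr => k _; rewrite linearZ /= nerve_diff_symbol /nerve_boundary.
  rewrite scaler_sumr big_mkord; apply: eq_bigr => i _.
  by rewrite scalerA -exprD addnC.
rewrite exchange_big /= big_mkord; apply: eq_bigr => j _.
rewrite linearZ /= prism_map_symbol /prism_chain scaler_sumr.
by apply: eq_bigr => k _; rewrite scalerA -exprD.
Qed.

End Prism.

(** * Marked homotopies *)

(** Each entry of a prism is a component of [tau] or the image of a marked arrow under [F] or
    [G]. *)
Lemma prism_map_marked (K : comPzRingType) (M N : marked_category)
    (F G : marked_morphism M N) (tau : forall a : M, hom (F a) (G a)) :
  (forall a, marked (tau a)) -> forall n x,
  x \in marked_chains K M n -> prism_map tau K n x \in marked_chains K N n.+1.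
Proof.
move=> tauM n x /asboolP[s sM ->]; rewrite linear_sum big_seq rpred_sum //.
move=> cv /sM[t tM ->]; rewrite linearZ rpredZ //= prism_map_symbol.
rewrite /prism_chain rpred_sum // => k _; rewrite rpredZ //.
apply: mem_span; exists (prism_simplex tau k t) => //.
case: t tM => a t; rewrite /all_marked /=.
have mapM m (b : M) (u : composable m b) :
    composable_all (fun _ _ f => marked f) u ->
    composable_all (fun _ _ f => marked f) (map_composable G u).
  elim: m b u => [|m IHm] b //= [c [f u]] [fM uM] /=.
  by split; [apply: mfun_marked | apply: IHm].
elim: n k a t {x s sM cv} => [|n IHn] [|k] a t tM; try by split; [|apply: mapM].
case: t tM => b [f t] [fM tM].
by split; [apply: mfun_marked | apply: IHn].
Qed.

Lemma one_step_chain_homotopic (K : comPzRingType) (M M' : marked_category)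
    (f g : marked_morphism M M') : one_step_homotopic f g ->
  chain_homotopic (Omega_map K f) (Omega_map K g) /\
  chain_homotopic (Psi_map K f) (Psi_map K g).
Proof.
(* With [f] and [g] replaced by restrictions of [H], their values compute to [H (a, false)] and
   [H (a, true)], so [tau] typechecks. *)
case=> H [<- <-]; set F := marked_comp H _; set G := marked_comp H _.
pose tau (a : M) : hom (F a) (G a) :=
  @fhom _ _ H (a, false) (a, true) (idm a, isT).
have tauM a : marked (tau a).
  exact: (@mfun_marked _ _ H _ _ _ (@BoxMarkedR M interval a false true isT I)).
have tauN (a b : M) (u : hom a b) :
    compose (fhom G u) (tau a) = compose (tau b) (fhom F u).
  (* Both composites are [H] applied to [u] paired with the arrow from 0 to 1. *)
  rewrite /= /tau -!fhom_comp /= comp1m compm1.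
  by congr (fhom H (_, _)); apply: bool_irrelevance.
have hM := prism_map_marked (K := K) tauM.
have h0 := prism_map_diff0 tau (K := K).
have hS := prism_map_diff tauN (K := K).
by split; [apply: inf_chain_homotopic h0 hS _ _ _ _ hM
          | apply: sup_chain_homotopic h0 hS _ _ _ _ hM].
Qed.

Theorem proposition10p9 (K : comPzRingType) (M M' : marked_category)
    (f g : marked_morphism M M') :
  homotopic f g ->
  chain_homotopic (Omega_map K f) (Omega_map K g) /\
  chain_homotopic (Psi_map K f) (Psi_map K g).
Proof.
(* Chain homotopy is itself an equivalence relation, so it absorbs the closure. *)
elim=> [{}f {}g|{}f|{}f {}g _ [fgO fgP]|{}f {}g k _ [fgO fgP] _ [gkO gkP]].
- exact: one_step_chain_homotopic.
- by split; apply: chain_homotopic_refl.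
- by split; apply: chain_homotopic_sym.
- by split; [apply: chain_homotopic_trans fgO gkO
            | apply: chain_homotopic_trans fgP gkP].
Qed.
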